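(* Let $d=1+2^{-k}$ be the discount factor and $\varepsilon=2^{-p}$ the approximation factor, for rational parameters $p,k>0$. Let $W$ be an infinite-length bounded weight sequence. Then $$0\le \mathit{DS}(W,d)-\mathsf{DSLow}(W,k,p)<d\cdot\varepsilon .$$
   Context: A weight sequence is a sequence of rational numbers. The discounted sum of an infinite bounded weight sequence $W=w_0w_1\dots$ with discount factor $d>1$ is $\mathit{DS}(W,d)=\sum_{i=0}^{\infty} w_i/d^i$. Given $k,p>0$, for $x\in\mathbb{R}$ let $\mathsf{roundLow}(x,k,p)$ be the largest integer multiple of $2^{-(p+k)}$ that is less than or equal to $x$. With $d=1+2^{-k}$, the lower gap value of a finite weight sequence $U$ is defined inductively by $\mathsf{gapLow}(U,k,p)=0$ if $|U|=0$, and $\mathsf{gapLow}(U,k,p)=\mathsf{roundLow}(d\cdot\mathsf{gapLow}(V,k,p)+v,\,k,\,p)$ if $U=V\cdot v$ (the sequence $V$ followed by the weight $v$). With $W[\dots n]$ the $n$-length prefix of $W$, $$\mathsf{DSLow}(W,k,p)=\lim_{n\to\infty}\frac{\mathsf{gapLow}(W[\dots n],k,p)}{d^{\,n-1}}$$ (this limit exists for bounded $W$). *)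

(* Defs.v *)
From mathcomp Require Export all_boot all_order all_algebra.
From mathcomp Require Export all_classical all_reals all_analysis.
Export Order.TTheory GRing.Theory Num.Theory numFieldNormedType.Exports.

Set Implicit Arguments.
Unset Strict Implicit.
Unset Printing Implicit Defensive.

#[global] Open Scope classical_set_scope.
#[global] Open Scope ring_scope.

Section DiscountedSum.
Variable R : realType.

Definition DS (W : nat -> rat) (d : R) : R :=
  limn (series (fun i => ratr (W i) / d ^+ i)).

Section Gap.
Variables k p : rat.

Definition discount : R := 1 + 2 `^ (- ratr k).

Definition approx : R := 2 `^ (- ratr p).

Definition resolution : R := 2 `^ (- ratr (p + k)).

Definition roundLow (x : R) : R :=
  (Num.floor (x / resolution))%:~R * resolution.

Lemma resolution_gt0 : 0 < resolution.
Proof. by rewrite powR_gt0. Qed.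

Lemma roundLow_multiple x : exists z : int, roundLow x = z%:~R * resolution.
Proof. by exists (Num.floor (x / resolution)). Qed.

Lemma roundLow_le x : roundLow x <= x.
Proof. by rewrite -ler_pdivlMr ?resolution_gt0// floor_le. Qed.

Lemma roundLow_max x (z : int) :
  z%:~R * resolution <= x -> z%:~R * resolution <= roundLow x.
Proof.
by rewrite -ler_pdivlMr ?resolution_gt0// -floor_ge_int
  ler_pM2r ?resolution_gt0// ler_int.
Qed.

(* The left fold consumes the last weight last: see gapLow_rcons. *)
Definition gapLow (U : seq rat) : R :=
  foldl (fun g v => roundLow (discount * g + ratr v)) 0 U.

Lemma gapLow_nil : gapLow [::] = 0.
Proof. by []. Qed.

Lemma gapLow_rcons V v :
  gapLow (rcons V v) = roundLow (discount * gapLow V + ratr v).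
Proof. by rewrite /gapLow foldl_rcons. Qed.

(* The exponent is an integer, so that it is -1 for the empty prefix. *)
Definition DSLow (W : nat -> rat) : R :=
  limn (fun n => gapLow (mkseq W n) / discount ^ (n%:Z - 1)).

End Gap.
End DiscountedSum.

Arguments discount R k : clear implicits.
Arguments approx R p : clear implicits.
Arguments resolution R k p : clear implicits.
Arguments DSLow R k p W : clear implicits.

(* Main.v *)
Require Import Defs.
From mathcomp Require Import ring.

Set Implicit Arguments.
Unset Strict Implicit.
Unset Printing Implicit Defensive.

(** Unfolding the recursion, [gapLow] of the [n]-prefix divided by [d ^ (n-1)]
    is the [n]-th partial sum of [(w_i - e_i) / d ^ i], where [e_i] is the
    rounding error of step [i].  Hence [DS - DSLow] is the discounted sum of the
    errors [0 <= e_i < resolution], and a constant sequence [c] has discounted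
    sum [c d / (d - 1)], where [resolution / (d - 1) = approx].  The upper bound
    is strict because the first term already is strictly smaller. *)

Section DiscountedSeries.
Variables (R : realType) (d : R).
Hypothesis d_gt1 : 1 < d.

Let d_gt0 : 0 < d. Proof. exact: lt_trans ltr01 d_gt1. Qed.

Let normV_lt1 : `|d^-1| < 1.
Proof. by rewrite ger0_norm ?invr_ge0 ?ltW// invf_lt1. Qed.

Lemma cvg_series_discount_cst (c : R) :
  series (fun i => c / d ^+ i) @ \oo --> c * (d / (d - 1)).
Proof.
have -> : (fun i => c / d ^+ i) = geometric c d^-1.
  by apply/funext => i /=; rewrite exprVn.
have -> : c * (d / (d - 1)) = c / (1 - d^-1).
  have d0 := lt0r_neq0 d_gt0.
  have d1 : d - 1 != 0 by rewrite subr_eq0 gt_eqF.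
  by field; rewrite d0 d1.
exact: cvg_geometric_series.
Qed.

(** Domination by the geometric series of [M / d ^+ i] gives absolute convergence. Both the weights
    and the rounding errors are bounded, so this serves for both. *)
Lemma is_cvg_series_discount (u : nat -> R) (M : R) :
  (forall i, `|u i| <= M) -> cvgn (series (fun i => u i / d ^+ i)).
Proof.
move=> uM; have M0 : 0 <= M := le_trans (normr_ge0 _) (uM 0%N).
have dX0 i : 0 <= d ^+ i by rewrite exprn_ge0 ?ltW.
apply: normed_cvg; apply: (@series_le_cvg _ _ (fun i => M / d ^+ i)) => [i|i|i|].
- exact: normr_ge0.
- by rewrite divr_ge0.
- by rewrite /= normrM normfV (ger0_norm (dX0 i)) ler_wpM2r ?invr_ge0.
- by apply/cvg_ex; eexists; exact: cvg_series_discount_cst.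
Qed.

End DiscountedSeries.

(** Partial sums of nonnegative terms increase to their limit. The empty sum ([n = 0]) yields a
    nonnegative limit; the first term ([n = 1]) yields a strictly positive one. *)
Lemma series_le_lim (R : realType) (u : R ^nat) n :
  (forall i, 0 <= u i) -> cvgn (series u) -> series u n <= limn (series u).
Proof.
move=> u0 cu; apply: nondecreasing_cvgn_le => // a b ab.
exact: nondecreasing_series.
Qed.

Lemma discounted_sum_bounds (R : realType) (d c : R) (e : nat -> R) :
  1 < d -> (forall i, 0 <= e i < c) ->
  0 <= limn (series (fun i => e i / d ^+ i)) < c * (d / (d - 1)).
Proof.
move=> d1 ec; have dX0 i : 0 <= d ^+ i by rewrite exprn_ge0// ltW// (lt_trans ltr01).
have e0 i : 0 <= e i by case/andP: (ec i).
have elt i : e i < c by case/andP: (ec i).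
set u := fun i => e i / d ^+ i; set v := fun i => c / d ^+ i.
have vc : series v @ \oo --> c * (d / (d - 1)) by exact: cvg_series_discount_cst.
have cv : cvgn (series v) by apply/cvg_ex; eexists; exact: vc.
have cu : cvgn (series u).
  by apply: (is_cvg_series_discount d1 (M := c)) => i; rewrite ger0_norm// ltW.
apply/andP; split.
  by have := @series_le_lim _ u 0%N (fun i => divr_ge0 (e0 i) (dX0 i)) cu;
    rewrite /series/= big_geq.
(* The strict bound becomes positivity of the sum of [v - u], which is at least its first term
   [c - e 0]. *)
rewrite -(cvg_lim _ vc)// -subr_gt0 -lim_seriesB//.
have vu0 i : 0 <= (v - u) i.
  have -> : (v - u) i = (c - e i) / d ^+ i by rewrite mulrBl.
  by rewrite divr_ge0// subr_ge0 ltW.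
apply: lt_le_trans (series_le_lim 1%N vu0 (is_cvg_seriesB cv cu)).
rewrite /series/= big_nat1 [X in 0 < X](_ : _ = c - e 0%N) ?subr_gt0//.
by rewrite [LHS]/(c / d ^+ 0 - e 0%N / d ^+ 0) !expr0 !divr1.
Qed.

Section RoundingError.
Variables (R : realType) (k p : rat).

Local Notation d := (discount R k).

Lemma discount_gt1 : 1 < d.
Proof. by rewrite ltrDl powR_gt0. Qed.

Lemma resolution_discount : resolution R k p * (d / (d - 1)) = d * approx R p.
Proof.
have t0 : 2 `^ (- ratr k) != 0 :> R by rewrite gt_eqF// powR_gt0.
rewrite /resolution /approx /discount rmorphD opprD powRD ?pnatr_eq0 ?implybT//.
by field; rewrite addrC addKr t0.
Qed.

Definition roundErr (x : R) : R := x - roundLow k p x.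

Lemma roundErr_bounds x : 0 <= roundErr x < resolution R k p.
Proof.
have r0 := resolution_gt0 R k p.
rewrite subr_ge0 roundLow_le /= ltrBlDl.
by have := floorD1_gt (x / resolution R k p);
  rewrite ltr_pdivrMr// intrD mulrDl mul1r.
Qed.

Definition gapErr (W : nat -> rat) (n : nat) : R :=
  roundErr (d * gapLow R k p (mkseq W n) + ratr (W n)).

(** With [g_n] the gap of the [n]-prefix, [g_(n+1) = d g_n + w_n - e_n]; dividing by [d ^ n] adds
    exactly the term of index [n]. At [n = 0] the exponent is -1, but the gap is 0. *)
Lemma gapLow_series (W : nat -> rat) n :
  gapLow R k p (mkseq W n) / d ^ (n%:Z - 1) =
  series ((fun i => ratr (W i) / d ^+ i) - (fun i => gapErr W i / d ^+ i)) n.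
Proof.
have d0 : d != 0 by rewrite gt_eqF// (lt_trans ltr01 discount_gt1).
elim: n => [|n IH]; first by rewrite gapLow_nil mul0r /series/= big_geq.
rewrite seriesSr -IH mkseqS gapLow_rcons.
rewrite [X in _ = _ + X](_ : _ = ratr (W n) / d ^+ n - gapErr W n / d ^+ n)//.
have dE m : d ^ (m%:Z - 1) = d ^+ m / d by rewrite expfzDr// exprN1.
rewrite !dE exprS /gapErr /roundErr.
by field; rewrite d0 expf_neq0.
Qed.

End RoundingError.

Theorem theorem1 (R : realType) (k p : rat) (W : nat -> rat)
    (hk : 0 < k) (hp : 0 < p)
    (hW : exists M : rat, forall n : nat, `|W n| <= M) :
  0 <= DS W (discount R k) - DSLow R k p W /\
  DS W (discount R k) - DSLow R k p W < discount R k * approx R p.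
Proof.
have d1 := discount_gt1 R k.
have eb n : 0 <= gapErr R k p W n < resolution R k p by exact: roundErr_bounds.
have cw : cvgn (series (fun i => ratr (W i) / discount R k ^+ i)).
  have [M WM] := hW; apply: (is_cvg_series_discount d1 (M := ratr M)) => i.
  by rewrite -ratr_norm ler_rat.
have ce : cvgn (series (fun i => gapErr R k p W i / discount R k ^+ i)).
  apply: (is_cvg_series_discount d1 (M := resolution R k p)) => i.
  by have /andP[? ?] := eb i; rewrite ger0_norm// ltW.
(* [DSLow] splits as [DS] minus the error sum because both series converge; subtracting it from [DS]
   leaves the error sum alone. *)
rewrite /DS /DSLow (funext (gapLow_series R k p W)) lim_seriesB// subKr.
by have /andP[] := discounted_sum_bounds d1 eb; rewrite resolution_discount.
Qed.
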